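(* Let $l \geq 0$ and $m\ge 1$ be integers, let $\Omega_0,\ldots,\Omega_{l+2} \subseteq \mathbb{R}$ be open sets and let $f_i:\Omega_i\to\Omega_{i+1}$, $0\le i\le l+1$, be univariate real-valued functions. Let $x_0 \in \Omega_0$ and $x_{i+1} := f_i(x_i)$, and assume that each $f_i$ is $m$-times differentiable at $x_i$. Then $$\nabla^{m}(f_{l+1}\circ f_l\circ\cdots\circ f_0)_{|x_0} = B^{[l+1]}_m\big( \nabla f_{l+1|x_{l+1}},\ldots,\nabla^m f_{l+1|x_{l+1}},\ \nabla f_{l|x_l},\ldots,\nabla^m f_{l|x_l},\ \ldots,\ \nabla f_{0|x_0},\ldots,\nabla^m f_{0|x_0}\big),$$ where $B^{[l+1]}_m$ denotes the higher-level Bell polynomial.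
   Context: $\nabla^k g_{|x}$ denotes the $k$-th derivative of $g$ at $x$. Partial Bell polynomials: for $1\le k\le m$, let $\mathcal{A}(m,k)$ be the set of $b=(b_1,\ldots,b_m)\in\mathbb{N}_0^m$ with $\sum_i b_i = k$ and $\sum_i i b_i = m$, let $A^b = \frac{m!}{\prod_{i=1}^m b_i!\,(i!)^{b_i}}$, and $B_{m,k}(x_1,\ldots,x_{m-k+1}) = \sum_{b\in\mathcal{A}(m,k)} A^b\prod_{j=1}^{m-k+1} x_j^{b_j}$. Set $$B_m(x^{[1]}_1,\ldots,x^{[1]}_m,x^{[0]}_1,\ldots,x^{[0]}_m) = \sum_{k=1}^m x^{[1]}_k B_{m,k}(x^{[0]}_1,\ldots,x^{[0]}_{m-k+1}).$$ Higher-level Bell polynomials: $B^{[1]}_{m,k} := B_{m,k}$, $B^{[1]}_m := B_m$, and recursively for $l\ge1$, $$B^{[l+1]}_{m,k}(x^{[l]}_1,\ldots,x^{[l]}_{m-k+1},\ldots,x^{[0]}_1,\ldots,x^{[0]}_{m-k+1}) := B_{m,k}\big(y_1,\ldots,y_{m-k+1}\big),$$ where $y_j := B^{[l]}_j(x^{[l]}_1,\ldots,x^{[l]}_j,\ x^{[l-1]}_1,\ldots,x^{[l-1]}_j,\ \ldots,\ x^{[0]}_1,\ldots,x^{[0]}_j)$, and $$B^{[l+1]}_m(x^{[l+1]}_1,\ldots,x^{[l+1]}_m,\ldots,x^{[0]}_1,\ldots,x^{[0]}_m) := \sum_{k=1}^m x^{[l+1]}_k\, B^{[l+1]}_{m,k}(x^{[l]}_1,\ldots,x^{[l]}_{m-k+1},\ldots,x^{[0]}_1,\ldots,x^{[0]}_{m-k+1}).$$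 *)

(* Defs.v *)
From mathcomp Require Import all_boot all_order all_algebra.
From mathcomp Require Import all_classical all_reals all_analysis.

Set Implicit Arguments.
Unset Strict Implicit.
Unset Printing Implicit Defensive.

Import Order.TTheory GRing.Theory Num.Theory.
Import numFieldNormedType.Exports.

Local Open Scope classical_set_scope.
Local Open Scope ring_scope.

(* [derive1] is total with a junk value where the derivative does not exist,
   so derivability of the top derivative at [x] alone is not enough: the lower
   derivatives have to exist on a neighborhood of [x].                        *)
Fixpoint times_differentiable (R : realType) (m : nat) (f : R -> R) (x : R)
    : Prop :=
  if m is m'.+1 then
    (\forall y \near x, times_differentiable m' f y) /\ derivable (derive1n m' f) x 1
  else True.

(* f (n - 1) \o ... \o f 0 *)
Fixpoint iter_comp (T : Type) (f : nat -> T -> T) (n : nat) : T -> T :=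
  if n is n'.+1 then f n' \o iter_comp f n' else id.

(* The multi-indices (b_1, ..., b_m) of A(m, k); b_j is stored at the ordinal
   j - 1. The codomain 'I_m.+1 loses nothing, since \sum_j j b_j = m with
   j >= 1 forces b_j <= m.                                                    *)
Definition bell_index (m k : nat) : {set {ffun 'I_m -> 'I_m.+1}} :=
  [set b : {ffun 'I_m -> 'I_m.+1} |
    (\sum_(i < m) b i == k)%N && (\sum_(i < m) i.+1 * b i == m)%N]%SET.

Definition bell_coef (R : realType) (m : nat) (b : {ffun 'I_m -> 'I_m.+1}) : R :=
  m`!%:R / \prod_(i < m) ((b i)`!%:R * (i.+1)`!%:R ^+ b i).

(* In all Bell polynomials the variables are numbered from 1: only the values
   x 1, x 2, ... of the argument x : nat -> R are used. The product below runs
   over the x_j with 1 <= j <= m - k + 1, where j = i + 1.                    *)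
Definition bell_partial (R : realType) (m k : nat) (x : nat -> R) : R :=
  \sum_(b in bell_index m k)
    bell_coef R b * \prod_(i < m | (i < m - k + 1)%N) x i.+1 ^+ b i.

Definition bell (R : realType) (m : nat) (x1 x0 : nat -> R) : R :=
  \sum_(1 <= k < m.+1) x1 k * bell_partial m k x0.

(* [higher_bell l m x] is B^{[l]}_m, where x i j stands for x^{[i]}_j. Starting
   from the convention B^{[0]}_m = x^{[0]}_m, a single recursion yields both the
   base case l = 1 and the recursive case; see the equations below.           *)
Fixpoint higher_bell (R : realType) (l m : nat) (x : nat -> nat -> R) : R :=
  if l is l'.+1 then
    \sum_(1 <= k < m.+1)
      x l k * bell_partial m k (fun j => higher_bell l' j x)
  else x 0%N m.

(* B^{[l]}_{m,k}, for l >= 1 *)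
Definition higher_bell_partial (R : realType) (l m k : nat)
    (x : nat -> nat -> R) : R :=
  bell_partial m k (fun j => higher_bell l.-1 j x).

Lemma higher_bell_partial1 (R : realType) m k (x : nat -> nat -> R) :
  higher_bell_partial 1 m k x = bell_partial m k (x 0%N).
Proof. by []. Qed.

Lemma higher_bell1 (R : realType) m (x : nat -> nat -> R) :
  higher_bell 1 m x = bell m (x 1%N) (x 0%N).
Proof. by []. Qed.

Lemma higher_bell_partialS (R : realType) l m k (x : nat -> nat -> R) :
  higher_bell_partial l.+1 m k x
  = bell_partial m k (fun j => higher_bell l j x).
Proof. by []. Qed.

Lemma higher_bellS (R : realType) l m (x : nat -> nat -> R) :
  higher_bell l.+1 m x
  = \sum_(1 <= k < m.+1) x l.+1 k * higher_bell_partial l.+1 m k x.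
Proof. by []. Qed.

(* Main.v *)
Require Import Defs.
From mathcomp Require Import all_boot all_order all_algebra.
From mathcomp Require Import all_classical all_reals all_analysis.
From mathcomp Require Import zify ring.

Set Implicit Arguments.
Unset Strict Implicit.
Unset Printing Implicit Defensive.

Import Order.TTheory GRing.Theory Num.Theory.
Import numFieldNormedType.Exports.

Local Open Scope classical_set_scope.
Local Open Scope ring_scope.

(** For two functions the claim is Faà di Bruno's formula
    [(f \o g)^(m) = \sum_k (f^(k) \o g) * B_(m,k)(g', g'', ...)], and the
    general case follows by composing one outer function at a time: the
    variables [y_j] substituted into the next Bell polynomial are exactly the
    derivatives of order [j] of the composition built so far.

    Faà di Bruno's formula ([derive1n_comp]) is proved by induction on [m],
    differentiating the formula for [m], which holds on a whole neighborhood of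
    the point. What makes the induction close is that, when every [x_j] has
    derivative [x_(j+1)], the Bell polynomials satisfy
    [B_(m+1,k) = (B_(m,k))' + x_1 B_(m,k-1)] ([is_derive_bell_partial]).

    This recurrence is read off from the generating function
    [P = \sum_(j >= 1) x_j X^j / j!], truncated to a polynomial ([bell_egf]).
    The multinomial theorem turns the sum over multi-indices into
    [B_(m,k) = m!/k! [X^m] P^k] ([bell_partial_egf]). Differentiating the
    coefficients of [P] in time shifts the sequence [x], so it agrees with
    [P' - x_1], where [P'] is the derivative in the formal variable; hence the
    time derivative of [P^k] is [(P^k)' - k x_1 P^(k-1)], and comparing the
    coefficients of [X^m] gives the recurrence. *)

(** * Multinomial expansion *)

(** A truncated form of [\prod_i exp (a_i Y) = exp ((\sum_i a_i) Y)]: the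
    coefficients of order at most [N] do not see the truncation, and multiplying
    by one more factor is the binomial theorem. *)
Lemma coef_prod_truncated_exp (F : numFieldType) (A : comAlgType F)
    (a : nat -> A) (n N k : nat) (k_le : (k <= N)%N) :
  (\prod_(i < n) \poly_(b < N.+1) (b`!%:R^-1 *: a i ^+ b))`_k
  = (k`!%:R : F)^-1 *: (\sum_(i < n) a i) ^+ k.
Proof.
elim: n k k_le => [|n IHn] k k_le.
  rewrite !big_ord0 coef1 expr0n.
  by case: k {k_le} => [|k]; rewrite ?fact0 ?invr1 ?scale1r ?scaler0.
rewrite !big_ord_recr/= mulrC coefM addrC exprDn scaler_sumr (reindex_inj rev_ord_inj).
apply: eq_bigr => -[j /= j_lt] _; rewrite ltnS in j_lt.
rewrite subSS subKn// IHn ?(leq_trans j_lt)// coef_poly.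
rewrite ltnS (leq_trans (leq_subr _ _) k_le) -scalerAl -scalerAr.
rewrite -(scaler_nat 'C(k, j)) !scalerA; congr (_ *: _).
have fact_neq0 i : i`!%:R != 0 :> F by rewrite pnatr_eq0 -lt0n fact_gt0.
rewrite -(bin_fact j_lt) !natrM !invfM mulrAC mulVf ?mul1r 1?mulrC//.
by rewrite pnatr_eq0 -lt0n bin_gt0.
Qed.

(** Expanding the product of truncated exponentials over all choices of one
    exponent per factor; the bound [N] on the exponents is harmless, since each
    [b i] is at most [k]. *)
Lemma multinomial_expansion (F : numFieldType) (A : comAlgType F)
    (a : nat -> A) (n N k : nat) (k_le : (k <= N)%N) :
  \sum_(b : {ffun 'I_n -> 'I_N.+1} | (\sum_(i < n) b i == k)%N)
    \prod_(i < n) ((b i)`!%:R^-1 *: a i ^+ b i)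
  = (k`!%:R : F)^-1 *: (\sum_(i < n) a i) ^+ k.
Proof.
rewrite -(coef_prod_truncated_exp a n k_le).
under [in RHS]eq_bigr do rewrite poly_def.
rewrite bigA_distr_bigA coef_sum big_mkcond; apply: eq_bigr => b _ /=.
by rewrite [in RHS]scaler_prod prodrXr coefZ coefXn eq_sym; case: eqP; rewrite ?mulr1 ?mulr0.
Qed.

(** * Generating function of the Bell polynomials *)

Definition bell_egf (F : numFieldType) (n : nat) (x : nat -> F) : {poly F} :=
  \sum_(i < n) (x i.+1 / i.+1`!%:R) *: 'X^(i.+1).

Lemma coef_bell_egf (F : numFieldType) n (x : nat -> F) j :
  (bell_egf n x)`_j = if (0 < j <= n)%N then x j / j`!%:R else 0.
Proof.
rewrite coef_sum; case: j => [|j] /=.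
  by apply: big1 => i _; rewrite coefZ coefXn mulr0.
under eq_bigr do rewrite coefZ coefXn eqSS.
case: ltnP => [j_lt|n_le].
  rewrite (bigD1 (Ordinal j_lt))//= eqxx mulr1 big1 ?addr0// => i.
  by rewrite -val_eqE eq_sym => /negbTE /= ->; rewrite mulr0.
by apply: big1 => i _; rewrite gtn_eqF ?mulr0// (leq_trans _ n_le).
Qed.

Lemma eq_coef_exp (F : comNzRingType) (p q : {poly F}) n
    (pq : forall i, (i <= n)%N -> p`_i = q`_i) k i :
  (i <= n)%N -> (p ^+ k)`_i = (q ^+ k)`_i.
Proof.
elim: k i => [|k IHk] i i_le; first by rewrite !expr0.
rewrite !exprS !coefM; apply: eq_bigr => -[j /= j_lt] _.
by rewrite pq ?IHk ?(leq_trans (leq_subr _ _))// (leq_trans _ i_le).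
Qed.

(** Subtracting the two constraints on [b] gives [\sum_j j * b j = m - k] for
    [j] counted from 0, so no index above [m - k] occurs. Hence the restriction
    on the product in [bell_partial] only drops factors equal to 1. *)
Lemma bell_index_support m k (b : {ffun 'I_m -> 'I_m.+1}) (i : 'I_m) :
  b \in bell_index m k -> ~~ (i < m - k + 1)%N -> b i = 0%N :> nat.
Proof.
rewrite inE => /andP[/eqP sum_b /eqP weight_b]; rewrite -leqNgt => i_ge.
have : (\sum_(j < m) j * b j + k = m)%N.
  rewrite -[in LHS]sum_b -[RHS]weight_b -big_split/=.
  by apply: eq_bigr => j _; rewrite mulSn addnC.
rewrite (bigD1 i)//= => weight0.
case: (val (b i)) weight0 => // c; rewrite mulnS => weight0.
by move: i_ge; rewrite -[X in (X - k)%N]weight0; lia.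
Qed.

(** The multinomial expansion of [P ^+ k] contributes to [X^m] exactly the
    multi-indices of weight [m]. The truncation order [n] is left free because
    the recurrence compares [B_(m,k)] and [B_(m+1,k)] in the same polynomial. *)
Lemma bell_partial_egf (R : realType) (m k n : nat) (x : nat -> R) :
  (k <= m)%N -> (m <= n)%N ->
  bell_partial m k x = m`!%:R / k`!%:R * (bell_egf n x ^+ k)`_m.
Proof.
move=> k_le m_le.
rewrite (@eq_coef_exp _ _ (bell_egf m x) m)//; last first.
  by move=> i i_le; rewrite !coef_bell_egf i_le (leq_trans i_le m_le).
rewrite -mulrA -coefZ -(multinomial_expansion
  (fun i => (x i.+1 / i.+1`!%:R) *: 'X^(i.+1)) m k_le) coef_sum mulr_sumr.
have coef_term (b : {ffun 'I_m -> 'I_m.+1}) :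
    (\prod_(i < m) ((b i)`!%:R^-1 *: ((x i.+1 / i.+1`!%:R) *: 'X^(i.+1)) ^+ b i))`_m
    = \prod_(i < m) ((b i)`!%:R^-1 * (x i.+1 / i.+1`!%:R) ^+ b i)
      * (\sum_(i < m) i.+1 * b i == m)%N%:R.
  under eq_bigr do rewrite exprZn -exprM scalerA.
  by rewrite scaler_prod prodrXr coefZ coefXn eq_sym.
under [RHS]eq_bigr do rewrite coef_term.
rewrite [RHS](bigID (fun b : {ffun 'I_m -> 'I_m.+1} =>
  \sum_(i < m) i.+1 * b i == m)%N)/= [X in _ = _ + X]big1 ?addr0; last first.
  by move=> b /andP[_ /negbTE ->]; rewrite !mulr0.
rewrite /bell_partial; apply: eq_big => b; first by rewrite inE.
move=> b_in; have := b_in; rewrite inE => /andP[_ ->]; rewrite mulr1.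
rewrite /bell_coef -mulrA -prodfV [X in _ * (_ * X)]big_mkcond/= -big_split/=; congr (_ * _).
apply: eq_bigr => i _; rewrite invfM exprMn exprVn -mulrA; congr (_ * _).
rewrite mulrC; case: ifPn => // /(bell_index_support b_in) ->.
by rewrite !expr0.
Qed.

Lemma bell_partial0 (R : realType) m (x : nat -> R) : bell_partial m.+1 0 x = 0.
Proof. by rewrite (bell_partial_egf _ _ (leqnn _))// expr0 coef1 mulr0. Qed.

Lemma bell_partial_diag (R : realType) n (x : nat -> R) :
  bell_partial n n x = x 1%N ^+ n.
Proof.
have n_neq0 : n`!%:R != 0 :> R by rewrite pnatr_eq0 -lt0n fact_gt0.
rewrite (bell_partial_egf _ (leqnn n) (leqnSn n)) divff// mul1r /bell_egf.
have -> : \sum_(i < n.+1) (x i.+1 / i.+1`!%:R) *: 'X^(i.+1)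
    = 'X * \sum_(i < n.+1) (x i.+1 / i.+1`!%:R) *: 'X^i.
  by rewrite mulr_sumr; apply: eq_bigr => i _; rewrite -scalerAr -exprS.
rewrite exprMn coefXnM ltnn subnn -horner_coef0 horner_exp horner_coef0.
rewrite coef_sum big_ord_recl big1/= ?addr0 => [|i _]; last first.
  by rewrite coefZ coefXn mulr0.
by rewrite coefZ coefXn mulr1 divr1.
Qed.

Lemma eq_bell_partial (R : realType) m k (x y : nat -> R) :
  (forall j, (0 < j <= m)%N -> x j = y j) ->
  bell_partial m k x = bell_partial m k y.
Proof.
move=> xy; apply: eq_bigr => b _; congr (_ * _); apply: eq_bigr => i _.
by rewrite xy//= ltn_ord.
Qed.

(** * Differentiation of Bell polynomials *)

(** The power rule for a polynomial moving with [t]. Only the derivatives of the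
    coefficients up to order [n] are assumed to exist: in the application [x_j]
    is a derivative of order [j], and the last one need not be differentiable. *)
Lemma is_derive_coef_exp (R : realType) (P : R -> {poly R}) (dP : {poly R}) (x : R) n
    (dP_coef : forall i, (i <= n)%N ->
       is_derive x 1 (fun t => (P t)`_i) dP`_i) k i :
  (i <= n)%N ->
  is_derive x 1 (fun t => (P t ^+ k)`_i) ((P x ^+ k.-1 * dP) *+ k)`_i.
Proof.
elim: k i => [|k IHk] i i_le.
  under eq_fun do rewrite expr0.
  by rewrite mulr0n coef0; exact: is_derive_cst.
have -> : (fun t => (P t ^+ k.+1)`_i)
    = \sum_(j < i.+1) (fun t => (P t)`_j * (P t ^+ k)`_(i - j)).
  by apply/funext => t; rewrite exprS coefM fct_sumE.
have -> : (P x ^+ k.+1.-1 * dP) *+ k.+1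
    = P x * ((P x ^+ k.-1 * dP) *+ k) + dP * P x ^+ k.
  rewrite mulrSr mulrnAr mulrA -exprS [dP * _]mulrC; congr (_ + _).
  by case: k {IHk} => [|k].
rewrite coefD !coefM -big_split/=; apply: is_derive_sum => j.
have j_le : (j <= n)%N by rewrite (leq_trans _ i_le)// -ltnS.
apply: is_derive_eq.
  apply: is_deriveM; first exact: dP_coef.
  by apply: IHk; rewrite (leq_trans (leq_subr _ _)).
by rewrite /= [X in _ + X]mulrC.
Qed.

(** With [P] the generating function at time [t], its time derivative is the
    formal derivative minus [x_1] up to order [m], so [(P ^+ k)] has time
    derivative [(P ^+ k)^`() - k x_1 P ^+ k.-1]; the coefficient of [X^m] in the
    formal derivative is [m.+1] times the next coefficient of [P ^+ k]. *)
Lemma is_derive_bell_partial (R : realType) (u : nat -> R -> R) (x : R) m k :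
  (k <= m)%N ->
  (forall j, (0 < j <= m)%N -> is_derive x 1 (u j) (u j.+1 x)) ->
  is_derive x 1 (fun t => bell_partial m k (u^~ t))
    (bell_partial m.+1 k (u^~ x)
     - if k is k'.+1 then u 1%N x * bell_partial m k' (u^~ x) else 0).
Proof.
move=> k_le du.
under eq_fun do rewrite (bell_partial_egf _ k_le (leqnSn m)).
have fact_neq0 i : i`!%:R != 0 :> R by rewrite pnatr_eq0 -lt0n fact_gt0.
pose P t := bell_egf m.+1 (u^~ t).
(* [P] is truncated at [m.+1] so that its formal derivative still has the
   correct coefficient of order [m]. *)
have dP i : (i <= m)%N ->
    is_derive x 1 (fun t => (P t)`_i) ((P x)^`() - (u 1%N x)%:P)`_i.
  move=> i_le; under eq_fun do rewrite coef_bell_egf.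
  rewrite coefB coef_deriv coef_bell_egf coefC/= ltnS i_le (leqW i_le).
  case: i i_le => [|i] i_le /=.
    by rewrite divr1 mulr1n subrr; exact: is_derive_cst.
  rewrite subr0.
  have -> : (fun t => u i.+1 t / i.+1`!%:R) = i.+1`!%:R^-1 \*: u i.+1.
    by apply/funext => t; rewrite mulrC.
  apply: (is_derive_eq (is_deriveZ _ (du i.+1 i_le))).
  rewrite /GRing.scale/= [in RHS]factS natrM; field.
  by rewrite fact_neq0 -natrD pnatr_eq0.
apply: (is_derive_eq (is_deriveZ (m`!%:R / k`!%:R)
  (is_derive_coef_exp dP k (leqnn m)))).
case: k k_le => [|k] k_le /=.
  by rewrite bell_partial0 mulr0n coef0 scaler0 subr0.
rewrite (bell_partial_egf _ (leqW k_le) (leqnn m.+1)).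
rewrite (bell_partial_egf _ (ltnW k_le) (leqnSn m)) -/(P x).
have -> : P x ^+ k * ((P x)^`() - (u 1%N x)%:P) *+ k.+1
    = (P x ^+ k.+1)^`() - (u 1%N x *+ k.+1) *: P x ^+ k.
  by rewrite deriv_exp/= mulrBr mulrnBl mulrC [_ * _%:P]mulrC mul_polyC scalerMnl.
rewrite coefB coef_deriv coefZ scalerBr; congr (_ - _).
  by rewrite /GRing.scale/= [in RHS]factS natrM -mulr_natr; ring.
rewrite /GRing.scale/= factS natrM; field.
by rewrite fact_neq0 nat1r pnatr_eq0.
Qed.

(** * Faà di Bruno's formula *)

Lemma times_differentiable_le (R : realType) (m n : nat) (f : R -> R) (x : R) :
  (n <= m)%N -> times_differentiable m f x -> times_differentiable n f x.
Proof.
elim: m => [|m IHm]; first by rewrite leqn0 => /eqP ->.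
by rewrite leq_eqVlt => /predU1P[->//|/IHm td_n] [/nbhs_singleton/td_n].
Qed.

Lemma times_differentiable_is_derive (R : realType) (m j : nat) (f : R -> R)
    (x : R) :
  (j < m)%N -> times_differentiable m f x ->
  is_derive x 1 (derive1n j f) (derive1n j.+1 f x).
Proof.
move=> j_lt /(times_differentiable_le j_lt)[_ /derivableP].
by rewrite derive1nS derive1E.
Qed.

(** Faà di Bruno's formula. Summing from [k = 0] makes it hold for [m = 0], where
    [B_(0,0) = 1], so the induction can start there; for positive [m] the extra
    term vanishes by [bell_partial0]. *)
Lemma derive1n_comp (R : realType) (m : nat) (f g : R -> R) (x : R) :
  times_differentiable m f (g x) -> times_differentiable m g x ->
  times_differentiable m (f \o g) x /\
  derive1n m (f \o g) x
  = \sum_(k < m.+1)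
      derive1n k f (g x) * bell_partial m k (fun j => derive1n j g x).
Proof.
elim: m x => [|m IHm] x td_f td_g.
  by split=> //; rewrite big_ord1 bell_partial_diag expr0 mulr1.
have dg : is_derive x 1 g (derive1n 1 g x).
  exact: (@times_differentiable_is_derive _ m.+1 0).
have g_cvg : {for x, continuous g}.
  by apply: differentiable_continuous; apply/derivable1_diffP.
have near_IH : \forall y \near x, times_differentiable m (f \o g) y /\
    derive1n m (f \o g) y
    = \sum_(k < m.+1)
        derive1n k f (g y) * bell_partial m k (fun j => derive1n j g y).
  have [near_f _] := td_f; have [near_g _] := td_g.
  near=> y; apply: IHm; last by near: y.
  by near: y; exact: (g_cvg _ near_f).
have d_comp : is_derive x 1 (derive1n m (f \o g))
    (\sum_(k < m.+2)
      derive1n k f (g x) * bell_partial m.+1 k (fun j => derive1n j g x)).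
  pose h (k : 'I_m.+1) := (derive1n k f \o g) *
    (fun y => bell_partial m k (fun j => derive1n j g y)).
  apply: (@near_eq_is_derive _ _ _ (\sum_(k < m.+1) h k)).
    apply: filterS near_IH => y [_ ->].
    by rewrite fct_sumE.
  apply: is_derive_eq.
    apply: is_derive_sum => k; apply: is_deriveM.
      apply: is_derive1_comp dg.
      exact: times_differentiable_is_derive (ltn_ord k) td_f.
    apply: is_derive_bell_partial; first by rewrite -ltnS.
    move=> j /andP[_ j_le].
    exact: times_differentiable_is_derive td_g.
  pose B n k := bell_partial n k (fun j => derive1n j g x).
  set d := derive1n 1 g x.
  have BS : B m.+1 m.+1 = d * B m m by rewrite /B !bell_partial_diag exprS.
  (* The chain rule on [f^(k) \o g] and the correction term of the recurrence
     produce the same summands shifted by one; the difference telescopes to the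
     single term [k = m.+1]. *)
  pose F k := derive1n k f (g x).
  pose shifted k := if k is k'.+1 then d * B m k' else 0.
  transitivity (\sum_(k < m.+1) F k * B m.+1 k
      + (\sum_(k < m.+1) F k.+1 * (d * B m k) - \sum_(k < m.+1) F k * shifted k)).
    rewrite -sumrB -big_split/=; apply: eq_bigr => k _.
    rewrite /GRing.scale/= mulrBr -addrA [X in _ + X = _]addrC; congr (_ + (_ - _)).
    by rewrite mulrC -mulrA.
  rewrite [in RHS]big_ord_recr; congr (_ + _).
  rewrite [X in X - _]big_ord_recr [X in _ - X]big_ord_recl mulr0 add0r addrC addKr.
  by rewrite -BS.
split; last by rewrite derive1nS derive1E derive_val.
split; last exact: ex_derive.
by apply: filterS near_IH => y [].
Unshelve. all: by end_near. Qed.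

(** * Chains of compositions *)

Theorem mainTheorem4 (R : realType) (l m : nat) (m_ge1 : (1 <= m)%N)
    (Omega : nat -> set R)
    (Omega_open : forall i : nat, (i <= l.+2)%N -> open (Omega i))
    (f : nat -> R -> R)
    (f_Omega : forall i : nat, (i <= l.+1)%N ->
       set_fun (Omega i) (Omega i.+1) (f i))
    (x : nat -> R)
    (x0_Omega : Omega 0%N (x 0%N))
    (xS : forall i : nat, (i <= l.+1)%N -> x i.+1 = f i (x i))
    (f_diff : forall i : nat, (i <= l.+1)%N ->
       times_differentiable m (f i) (x i)) :
  times_differentiable m (iter_comp f l.+2) (x 0%N) /\
  derive1n m (iter_comp f l.+2) (x 0%N)
    = higher_bell l.+1 m (fun i j => derive1n j (f i) (x i)).
Proof.
set X := fun i j => _.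
have iter_x n : (n <= l.+2)%N -> iter_comp f n (x 0%N) = x n.
  by elim: n => //= n IHn n_le; rewrite IHn 1?ltnW// xS.
(* The orders below [m] are needed as well: they are the arguments of the Bell
   polynomials at the next level. *)
suff chain n : (n <= l.+1)%N -> forall j, (0 < j <= m)%N ->
    times_differentiable j (iter_comp f n.+1) (x 0%N) /\
    derive1n j (iter_comp f n.+1) (x 0%N) = higher_bell n j X.
  by apply: chain => //; rewrite m_ge1 leqnn.
elim: n => [|n IHn] n_le j /andP[j_gt0 j_le].
  split=> //; exact: times_differentiable_le j_le (f_diff 0%N isT).
have {}IHn := IHn (ltnW n_le).
have [|td_j _] := IHn j; first by rewrite j_gt0.
have [|td_comp ->] := @derive1n_comp R j (f n.+1) (iter_comp f n.+1) (x 0%N) _ td_j.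
  rewrite iter_x; last exact: ltnW.
  exact: times_differentiable_le j_le (f_diff _ n_le).
split=> //; rewrite iter_x; last exact: ltnW.
case: j j_gt0 j_le {td_j td_comp} => // j _ j_le.
rewrite big_ord_recl bell_partial0 mulr0 add0r /= big_add1 big_mkord.
apply: eq_bigr => k _; congr (_ * _); apply: eq_bell_partial => i /andP[i_gt0 i_le].
by have [|_ ->] := IHn i; first by rewrite i_gt0 (leq_trans i_le).
Qed.
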